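(* Let $n\in\mathbb{N}$, $n\ge 1$, and let $(a,b)$ be a finite or infinite open interval of $\mathbb{R}$. Let $\mathcal{G}_{n+1}$ and $\mathcal{Q}_{n+1}$ be monic real polynomials of degree $n+1$ all of whose zeros are real and lie in $(a,b)$. Denote the zeros of $\mathcal{G}_{n+1}$ in ascending order by $x_{1,n+1},\dots,x_{n+1,n+1}$, and suppose that $\mathcal{G}_{n+1}\prec\mathcal{Q}_{n+1}$ or $\mathcal{Q}_{n+1}\prec\mathcal{G}_{n+1}$. Let $\mathcal{P}_n$ be a monic real polynomial of degree $n$ with $n$ real zeros such that $$A(x)\mathcal{P}_n(x)=B(x)\mathcal{G}_{n+1}(x)+(x-E)\mathcal{Q}_{n+1}(x),$$ where $E\in\mathbb{R}$, $A$ and $B$ are real-valued functions continuous on $(a,b)$ (with $B$ also defined at $E$), and $A(x)>0$ on $(a,b)$. Assume also that $B(E)\neq 0$ and that $\mathcal{G}_{n+1}$ and $\mathcal{P}_n$ have no common zeros. 1. If $\mathcal{Q}_{n+1}\prec\mathcal{G}_{n+1}$, then $E<x_{n+1,n+1}$ and $(x-E)\mathcal{P}_n(x)\prec\mathcal{G}_{n+1}(x)$. Moreover, $\mathcal{G}_{n+1}\prec\mathcal{P}_n$ if and only if $E<x_{1,n+1}$. 2. If $\mathcal{G}_{n+1}\prec\mathcal{Q}_{n+1}$, then $E>x_{1,n+1}$ and $\mathcal{G}_{n+1}(x)\prec(x-E)\mathcal{P}_n(x)$. Moreover, $\mathcal{G}_{n+1}\prec\mathcal{P}_n$ if and only if 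$E>x_{n+1,n+1}$.
   Context: Notation $\prec$ for real polynomials $p,q$ with real and distinct zeros: - If $\deg p=\deg q=m$, with zeros $x_1<\dots<x_m$ of $p$ and $y_1<\dots<y_m$ of $q$, then $p\prec q$ means $x_1<y_1<x_2<y_2<\cdots<y_{m-1}<x_m<y_m$. - If $\deg p=m$ and $\deg q=m-1$, with zeros $x_1<\dots<x_m$ of $p$ and $y_1<\dots<y_{m-1}$ of $q$, then $p\prec q$ means $x_1<y_1<x_2<y_2<\cdots<y_{m-1}<x_m$. In particular, $p\prec q$ includes the assertion that the zeros of $p$ and of $q$ are real and distinct. The displayed identity is assumed to hold for all $x\in(a,b)$. *)

(* Defs.v *)
From mathcomp Require Import all_boot all_order all_algebra.
From mathcomp Require Import all_classical all_reals all_analysis.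

Set Implicit Arguments.
Unset Strict Implicit.
Unset Printing Implicit Defensive.

Import Order.TTheory GRing.Theory Num.Theory.
Import numFieldNormedType.Exports.

Local Open Scope classical_set_scope.
Local Open Scope ring_scope.

(* All zeros of the nonzero polynomial p are real, and s lists them with
   multiplicity, in some order. *)
Definition lists_zeros (R : realType) (p : {poly R}) (s : seq R) : Prop :=
  p != 0 /\ p = lead_coef p *: \prod_(z <- s) ('X - z%:P).

Definition real_rooted (R : realType) (p : {poly R}) : Prop :=
  exists s : seq R, lists_zeros p s.

(* With x and y the increasing lists of the simple real zeros of p and q, the
   chain x_1 < y_1 < x_2 < y_2 < ... ends with y_m when deg q = deg p = m, and
   with x_m when deg p = m and deg q = m - 1.  The two index conditions below
   range over exactly the terms present in either case; no index is out of
   bounds. *)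
Definition prec (R : realType) (p q : {poly R}) : Prop :=
  exists x y : seq R,
    [/\ lists_zeros p x /\ lists_zeros q y,
        sorted <%R x /\ sorted <%R y,
        size x = size y \/ size x = (size y).+1,
        forall i : nat, (i < size y)%N -> x`_i < y`_i &
        forall i : nat, (i.+1 < size x)%N -> y`_i < x`_i.+1].

(* Finite or infinite open interval: the endpoints may be -oo and +oo. *)
Definition ext_itv (R : realType) (a b : \bar R) : set R :=
  [set x | (a < x%:E)%E /\ (x%:E < b)%E].

(* Main.v *)
(* Put H = (X - E) P.  At a zero x_i of G the identity gives
   A(x_i) H(x_i) = (x_i - E)^2 Q(x_i), which is nonzero because G and P have no
   common zero; hence H and Q have the same sign at every zero of G.  Being
   monic and real-rooted of the same degree, they also have the same sign at any
   point w beyond all zeros.  With w taken to the left of everything if Q < G,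
   and to the right of everything if G < Q, the n + 2 points formed by w and the
   zeros of G strictly interlace with the n + 1 zeros of Q, so H changes sign on
   each of the n + 1 gaps and has exactly one zero in each.  The zero in the gap
   ending at w is the only one that is not enclosed by zeros of G, and G < P
   holds exactly when that zero is E. *)
Require Import Defs.
From mathcomp Require Import all_boot all_order all_algebra.
From mathcomp Require Import all_classical all_reals all_analysis.
From mathcomp Require Import polyrcf.

Set Implicit Arguments.
Unset Strict Implicit.
Unset Printing Implicit Defensive.

Import Order.TTheory GRing.Theory Num.Theory.
Import numFieldNormedType.Exports.

Local Open Scope classical_set_scope.
Local Open Scope ring_scope.

(** * Signs of products of linear factors to either side of all zeros *)

Lemma horner_prod_XsubC (R : comNzRingType) (s : seq R) (t : R) :
  (\prod_(z <- s) ('X - z%:P)).[t] = \prod_(z <- s) (t - z).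
Proof. by rewrite horner_prod; apply: eq_bigr => z _; rewrite hornerXsubC. Qed.

Lemma prod_sub_gt0 (R : numDomainType) (s : seq R) (t : R) :
  (forall z, z \in s -> z < t) -> 0 < \prod_(z <- s) (t - z).
Proof. by move=> h; rewrite big_seq prodr_gt0 // => z /h; rewrite subr_gt0. Qed.

Lemma prod_sub_sign (R : numDomainType) (s : seq R) (t : R) :
  (forall z, z \in s -> t < z) ->
  0 < (-1) ^+ size s * \prod_(z <- s) (t - z).
Proof.
elim: s => [_|z s IHs h]; first by rewrite big_nil mulr1 ltr01.
rewrite big_cons /= exprS mulrACA mulN1r opprB mulr_gt0 //.
  by rewrite subr_gt0 h ?mem_head.
by apply: IHs => u us; rewrite h // inE us orbT.
Qed.

Lemma exists_lt_all (R : realDomainType) (s : seq R) :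
  exists t : R, forall z, z \in s -> t < z.
Proof.
elim: s => [|u s [t ht]]; first by exists 0.
exists (Num.min t (u - 1)) => z; rewrite inE => /orP[/eqP->|/ht tz].
  by rewrite gt_min [X in _ || X]ltrBlDr ltrDl ltr01 orbT.
by rewrite gt_min tz.
Qed.

Lemma exists_gt_all (R : realDomainType) (s : seq R) :
  exists t : R, forall z, z \in s -> z < t.
Proof.
have [t ht] := exists_lt_all [seq - z | z <- s].
by exists (- t) => z zs; rewrite ltrNr ht // map_f.
Qed.

(** * Zeros separated by a chain of nodes *)

Section Interlacing.
Variable R : rcfType.
Implicit Types (w : nat -> R) (y z : seq R) (m : nat).

(** The nodes form a function rather than a list, so that the zeros of G can be extended by an extra
    node at either end. *)
Definition interlaced m w y := forall i, (i < m)%N -> w i < y`_i < w i.+1.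

Lemma interlaced_lt m w y i j : interlaced m w y ->
  (i < j <= m)%N -> w i < w j.
Proof.
move=> h; elim: j => // j IHj /andP[ij jm].
have /andP[wy yw] := h j jm; have wj := lt_trans wy yw.
move: ij; rewrite ltnS leq_eqVlt => /predU1P[->//|ij].
by apply: lt_trans wj; rewrite IHj // ij ltnW.
Qed.

Lemma interlaced_le m w y i j : interlaced m w y ->
  (i <= j <= m)%N -> w i <= w j.
Proof.
move=> h /andP[]; rewrite leq_eqVlt => /predU1P[->//|ij jm].
by apply/ltW/(interlaced_lt h); rewrite ij.
Qed.

Lemma interlaced_sorted m w y : size y = m -> interlaced m w y -> sorted <%R y.
Proof.
move=> sy h; apply/(sortedP 0) => i; rewrite sy => im.
have /andP[_ h1] := h i (ltnW im); have /andP[h2 _] := h _ im.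
exact: lt_trans h2.
Qed.

(** Between neighbouring nodes only the factor of index i changes sign. *)
Lemma interlaced_sign_change m w y i : size y = m -> interlaced m w y ->
  (i < m)%N ->
  (\prod_(z <- y) (w i - z)) * (\prod_(z <- y) (w i.+1 - z)) < 0.
Proof.
move=> sy h im; rewrite -big_split /= (big_nth 0) big_mkord sy.
rewrite (bigD1 (Ordinal im)) //= pmulr_llt0.
  by have /andP[wy yw] := h i im; rewrite nmulr_rlt0 ?subr_gt0 // subr_lt0.
(* For j other than i, the zero of index j lies outside the gap i, so its two factors have the same
   sign. *)
apply: prodr_gt0 => j ji; have /andP[wy yw] := h j (ltn_ord j).
have [ij|ij|ij] := ltngtP i j; last by rewrite -val_eqE /= ij eqxx in ji.
  have wi : w i.+1 <= w j by apply: (interlaced_le h); rewrite ij ltnW.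
  rewrite nmulr_rgt0 subr_lt0; first exact: le_lt_trans wi wy.
  have /andP[a b] := h i im.
  by apply: lt_trans (lt_trans a b) _; apply: le_lt_trans wi wy.
have wi : w j.+1 <= w i by apply: (interlaced_le h); rewrite ij ltnW.
have yi : y`_j < w i by apply: lt_le_trans yw wi.
have /andP[a b] := h i im.
by rewrite mulr_gt0 ?subr_gt0 //; apply: lt_trans yi (lt_trans a b).
Qed.

(** The intermediate value theorem gives a root of H in each gap; these m roots are distinct and H
    is monic of degree m, so they are all its zeros. *)
Lemma interlaced_same_sign m w y (H : {poly R}) :
  H \is monic -> size H = m.+1 -> size y = m -> interlaced m w y ->
  (forall i, (i <= m)%N -> 0 < H.[w i] * (\prod_(z <- y) (w i - z))) ->
  exists z, [/\ H = \prod_(c <- z) ('X - c%:P), size z = m & interlaced m w z].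
Proof.
move=> Hm sH sy hy hs.
have /choice[f hf] (i : nat) :
    exists c : R, (i < m)%N -> w i < c < w i.+1 /\ root H c.
  (* The choice function must be total; its value beyond the last gap is arbitrary. *)
  have [im|im] := ltnP i m; last by exists 0.
  have [||c] := @poly_ivtoo _ H (w i) (w i.+1).
  - by apply/ltW/(interlaced_lt hy); rewrite ltnSn.
  (* The two positive products from [hs] multiply to [H.[w i] * H.[w i.+1]] times the negative
     number of [hn]. *)
  - have hn := interlaced_sign_change sy hy im.
    have := mulr_gt0 (hs i (ltnW im)) (hs i.+1 im).
    by rewrite mulrACA nmulr_lgt0.
  by move=> ic rc; exists c => _; split=> //; rewrite !(itvP ic).
pose z := mkseq f m; have sz : size z = m by rewrite size_mkseq.
have hz : interlaced m w z.
  by move=> i im; rewrite nth_mkseq //; case: (hf i im).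
exists z; split=> //.
have uz := lt_sorted_uniq (interlaced_sorted sz hz).
have := @all_roots_prod_XsubC _ H z; rewrite (monicP Hm) scale1r; apply.
- by rewrite sz.
- by apply/allP => c /mapP[i]; rewrite mem_iota /= => im ->; case: (hf i im).
- by rewrite uniq_rootsE.
Qed.

End Interlacing.

(** * Uniqueness of the ordered list of zeros *)

Section ListsZeros.
Variable R : realType.
Implicit Types (p q : {poly R}) (s t x y : seq R).

Lemma lists_zeros_monic p s : p \is monic -> lists_zeros p s ->
  p = \prod_(z <- s) ('X - z%:P).
Proof. by move=> pm [_]; rewrite (monicP pm) scale1r. Qed.

Lemma lists_zeros_prod s : lists_zeros (\prod_(z <- s) ('X - z%:P)) s.
Proof.
split; first by rewrite monic_neq0 ?monic_prod_XsubC.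
by rewrite lead_coef_prod_XsubC scale1r.
Qed.

(** Unique factorisation makes the lists permutations of each other. This identifies the lists
    hidden under the existential of [prec] with the given zeros. *)
Lemma lists_zeros_sorted_eq s t :
  lists_zeros (\prod_(z <- s) ('X - z%:P)) t ->
  sorted <=%R s -> sorted <=%R t -> t = s.
Proof.
move=> /(lists_zeros_monic (monic_prod_XsubC _ _ _)) /prod_XsubC_eq st ss tt.
by apply: (sorted_eq le_trans le_anti) => //; rewrite perm_sym.
Qed.

Lemma prec_prod x y : sorted <%R x -> sorted <%R y ->
  size x = size y \/ size x = (size y).+1 ->
  (forall i, (i < size y)%N -> x`_i < y`_i) ->
  (forall i, (i.+1 < size x)%N -> y`_i < x`_i.+1) ->
  prec (\prod_(z <- x) ('X - z%:P)) (\prod_(z <- y) ('X - z%:P)).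
Proof.
by move=> sx sy sz h1 h2; exists x, y; split=> //; split=> //;
  apply: lists_zeros_prod.
Qed.

End ListsZeros.

(** * Position of the zeros of H = (X - E) P relative to those of G *)

Section ZerosOfH.
Variable R : realType.
Variables (n : nat) (E : R) (x y p : seq R).
Let G := \prod_(z <- x) ('X - z%:P).
Let P := \prod_(z <- p) ('X - z%:P).
Let H := ('X - E%:P) * P.
Hypotheses (sx : size x = n.+1) (sy : size y = n.+1) (sp : size p = n).
Hypothesis ox : sorted <%R x.
Hypothesis same_sign : forall i, (i <= n)%N ->
  0 < H.[x`_i] * (\prod_(z <- y) (x`_i - z)).

Let HE : H = \prod_(z <- E :: p) ('X - z%:P).
Proof. by rewrite big_cons. Qed.

Let Hmonic : H \is monic.
Proof. by rewrite HE monic_prod_XsubC. Qed.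

Let sH : size H = n.+2.
Proof. by rewrite HE size_prod_XsubC /= sp. Qed.

Let x_le i j : (i <= j <= n)%N -> x`_i <= x`_j.
Proof.
move=> /andP[ij jn]; apply: le_sorted_leq_nth => //.
  exact: (sub_sorted (@ltW _ R)).
  by rewrite inE sx ltnS (leq_trans ij).
by rewrite inE sx.
Qed.

Lemma perm_zeros z : H = \prod_(c <- z) ('X - c%:P) -> perm_eq (E :: p) z.
Proof. by rewrite HE => /prod_XsubC_eq. Qed.

Lemma zeros_interlace_below :
  (forall i, (i <= n)%N -> y`_i < x`_i) ->
  (forall i, (i < n)%N -> x`_i < y`_i.+1) ->
  exists z, [/\ H = \prod_(c <- z) ('X - c%:P), size z = n.+1, sorted <%R z,
    forall i, (i <= n)%N -> z`_i < x`_i &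
    forall i, (i < n)%N -> x`_i < z`_i.+1].
Proof.
move=> h1 h2; have [t ht] := exists_lt_all (E :: p ++ y).
(* The extra node t comes first, so the zeros of G are shifted by one index. *)
pose w := nth 0 (t :: x).
have hy : interlaced n.+1 w y.
  case=> [|i]; rewrite /w /= => im; last by rewrite h1 ?h2.
  by rewrite h1 // andbT ht // inE mem_cat mem_nth ?sy ?orbT.
have [|z [Hz sz hz]] := interlaced_same_sign Hmonic sH sy hy.
  case=> [|i]; rewrite /w /= => im; last exact: same_sign.
  rewrite HE horner_prod_XsubC.
  have /prod_sub_sign a : forall z, z \in E :: p -> t < z.
    by move=> z zs; rewrite ht // -cat_cons mem_cat zs.
  have /prod_sub_sign b : forall z, z \in y -> t < z.
    by move=> z zs; rewrite ht // -cat_cons mem_cat zs orbT.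
  (* H and Q both have n + 1 zeros, so the two signs (-1)^(n+1) cancel. *)
  have := mulr_gt0 a b; rewrite /= sp sy mulrACA -exprD addnn.
  by rewrite -mul2n exprM sqrrN !expr1n mul1r.
exists z; split=> //; first exact: interlaced_sorted hz.
  by move=> i im; have /andP[] := hz i im.
by move=> i im; have /andP[] := hz i.+1 im.
Qed.

Lemma zeros_interlace_above :
  (forall i, (i <= n)%N -> x`_i < y`_i) ->
  (forall i, (i < n)%N -> y`_i < x`_i.+1) ->
  exists z, [/\ H = \prod_(c <- z) ('X - c%:P), size z = n.+1, sorted <%R z,
    forall i, (i <= n)%N -> x`_i < z`_i &
    forall i, (i < n)%N -> z`_i < x`_i.+1].
Proof.
move=> h1 h2; have [t ht] := exists_gt_all (E :: p ++ y).
(* The default value t of [nth] serves as the node of index n + 1. *)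
pose w := nth t x.
have wx i : (i <= n)%N -> w i = x`_i.
  by move=> im; rewrite /w (set_nth_default 0) ?sx.
have wn : w n.+1 = t by rewrite /w nth_default ?sx.
have hy : interlaced n.+1 w y.
  move=> i im; rewrite wx // h1 //=.
  move: im; rewrite ltnS leq_eqVlt => /predU1P[->|im]; last by rewrite wx ?h2.
  by rewrite wn ht // inE mem_cat mem_nth ?sy ?orbT.
have [|z [Hz sz hz]] := interlaced_same_sign Hmonic sH sy hy.
  move=> i; rewrite leq_eqVlt => /predU1P[->|im]; last by rewrite wx ?same_sign.
  rewrite wn HE horner_prod_XsubC mulr_gt0 // prod_sub_gt0 // => z zs;
    by rewrite ht // -cat_cons mem_cat zs ?orbT.
exists z; split=> //; first exact: interlaced_sorted hz.
  by move=> i im; have /andP[] := hz i im; rewrite wx.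
by move=> i im; have /andP[_] := hz i (ltnW im); rewrite wx.
Qed.

Lemma prec_below :
  (forall i, (i <= n)%N -> y`_i < x`_i) ->
  (forall i, (i < n)%N -> x`_i < y`_i.+1) ->
  [/\ E < x`_n, prec H G & prec G P <-> E < x`_0].
Proof.
move=> h1 h2; have [z [Hz sz oz z1 z2]] := zeros_interlace_below h1 h2.
have Ez := perm_zeros Hz.
have /(nthP 0)[k] : E \in z by rewrite -(perm_mem Ez) mem_head.
rewrite sz ltnS => kn zk; split.
- by rewrite -zk (lt_le_trans (z1 k kn)) // x_le // kn leqnn.
- rewrite Hz; apply: prec_prod; rewrite ?sx ?sz //; first by left.
split=> [[x' [p' [[lx lp] [ox' op'] _ g1 g2]]]|Ex].
  have x'x : x' = x.
    by apply: (lists_zeros_sorted_eq lx); exact: (sub_sorted (@ltW _ R)).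
  have pp := prod_XsubC_eq (lists_zeros_monic (monic_prod_XsubC _ _ _) lp).
  (* The least zero of H lies below x_0, while every zero of P exceeds x_0 when G precedes P; hence
     that zero is E. *)
  have : z`_0 \in E :: p by rewrite (perm_mem Ez) mem_nth ?sz.
  rewrite inE => /predU1P[<-|]; first exact: z1.
  rewrite (perm_mem pp) => /(nthP 0)[j jp pz].
  have := z1 0%N isT; rewrite -pz => /(lt_trans (g1 j jp)).
  by rewrite x'x ltNge x_le //= -sp (perm_size pp) ltnW.
(* Every later zero of H exceeds x_0, so E must be the first one. *)
have k0 : k = 0%N.
  case: k kn zk => // k kn zk; have := z2 k kn; rewrite zk => /lt_trans/(_ Ex).
  by rewrite ltNge x_le //= ltnW.
(* Removing E from the head leaves the zeros of P, with indices lowered by one; the two chains of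
   inequalities thereby exchange roles. *)
case: z Hz sz oz z1 z2 Ez zk => // c z Hz [sz] oz z1 z2 Ez.
rewrite k0 /= => cE; rewrite cE perm_cons in Ez.
rewrite /P (perm_big _ Ez) /=; apply: prec_prod; rewrite ?sx ?sz //.
- exact: path_sorted oz.
- by right.
- by move=> i im; exact: (z1 i.+1 im).
Qed.

Lemma prec_above :
  (forall i, (i <= n)%N -> x`_i < y`_i) ->
  (forall i, (i < n)%N -> y`_i < x`_i.+1) ->
  [/\ x`_0 < E, prec G H & prec G P <-> x`_n < E].
Proof.
move=> h1 h2; have [z [Hz sz oz z1 z2]] := zeros_interlace_above h1 h2.
have Ez := perm_zeros Hz.
have /(nthP 0)[k] : E \in z by rewrite -(perm_mem Ez) mem_head.
rewrite sz ltnS => kn zk; split.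
- by rewrite -zk (le_lt_trans _ (z1 k kn)) // x_le.
- rewrite Hz; apply: prec_prod; rewrite ?sx ?sz //; first by left.
split=> [[x' [p' [[lx lp] [ox' op'] _ g1 g2]]]|Ex].
  have x'x : x' = x.
    by apply: (lists_zeros_sorted_eq lx); exact: (sub_sorted (@ltW _ R)).
  have pp := prod_XsubC_eq (lists_zeros_monic (monic_prod_XsubC _ _ _) lp).
  (* The greatest zero of H lies above x_n, while every zero of P is below x_n when G precedes P. *)
  have : z`_n \in E :: p by rewrite (perm_mem Ez) mem_nth ?sz.
  rewrite inE => /predU1P[<-|]; first exact: z1.
  rewrite (perm_mem pp) => /(nthP 0)[j jp pz].
  rewrite -(perm_size pp) sp in jp.
  have := z1 n (leqnn n); rewrite -pz => /lt_trans/(_ (g2 j _)).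
  rewrite x'x sx ltnS jp => /(_ isT); rewrite ltNge x_le //.
  by rewrite jp leqnn.
have kE : k = n.
  apply/eqP; rewrite eqn_leq kn leqNgt; apply/negP => kltn.
  have := z2 k kltn; rewrite zk => /(lt_trans Ex).
  by rewrite ltNge x_le // kltn leqnn.
(* Here E is the last zero of H; removing it leaves the zeros of P with unchanged indices. *)
case/lastP: z Hz sz oz z1 z2 Ez zk => // z c Hz.
rewrite size_rcons => -[sz] oz z1 z2 Ez.
rewrite kE nth_rcons sz ltnn eqxx => cE.
rewrite cE perm_sym perm_rcons perm_sym perm_cons in Ez.
have zi i : (i < n)%N -> (rcons z c)`_i = z`_i.
  by move=> im; rewrite nth_rcons sz im.
rewrite /P (perm_big _ Ez) /=; apply: prec_prod; rewrite ?sx ?sz //.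
- by apply: subseq_lt_sorted oz; rewrite -cats1 prefix_subseq.
- by right.
- by move=> i im; rewrite -zi //; apply/z1/ltnW.
- by move=> i im; rewrite -zi //; apply/z2.
Qed.

End ZerosOfH.

(** * From the identity to equal signs at the zeros of G *)

Theorem theorem2p1 (R : realType) (n : nat) (a b : \bar R)
    (G Q P : {poly R}) (x : seq R) (A B : R -> R) (E : R)
    (hn : (1 <= n)%N) (hab : (a < b)%E)
    (hGmonic : G \is monic) (hGdeg : size G = n.+2)
    (hQmonic : Q \is monic) (hQdeg : size Q = n.+2)
    (hGreal : real_rooted G) (hQreal : real_rooted Q)
    (hGab : forall z : R, root G z -> ext_itv a b z)
    (hQab : forall z : R, root Q z -> ext_itv a b z)
    (hx : lists_zeros G x) (hxsorted : sorted <=%R x)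
    (hGQ : prec G Q \/ prec Q G)
    (hPmonic : P \is monic) (hPdeg : size P = n.+1) (hPreal : real_rooted P)
    (hA : {within ext_itv a b, continuous A})
    (hB : {within ext_itv a b, continuous B})
    (hApos : forall t : R, ext_itv a b t -> 0 < A t)
    (hid : forall t : R, ext_itv a b t ->
      A t * P.[t] = B t * G.[t] + (t - E) * Q.[t])
    (hBE : B E != 0)
    (hGP : forall z : R, ~ (root G z /\ root P z)) :
  (prec Q G ->
     [/\ E < x`_n,
         prec (('X - E%:P) * P) G &
         prec G P <-> E < x`_0]) /\
  (prec G Q ->
     [/\ x`_0 < E,
         prec G (('X - E%:P) * P) &
         prec G P <-> x`_n < E]).
Proof.
have [p lp] := hPreal; have {lp}Pp := lists_zeros_monic hPmonic lp.
have Gx := lists_zeros_monic hGmonic hx.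
have sp : size p = n by apply/eqP; rewrite -eqSS -hPdeg Pp size_prod_XsubC.
have sx : size x = n.+1 by apply/eqP; rewrite -eqSS -hGdeg Gx size_prod_XsubC.
have sameS y i : Q = \prod_(z <- y) ('X - z%:P) -> (i <= n)%N ->
    0 < (('X - E%:P) * \prod_(z <- p) ('X - z%:P)).[x`_i]
        * (\prod_(z <- y) (x`_i - z)).
  move=> Qy im; rewrite -horner_prod_XsubC -Qy -Pp hornerM hornerXsubC.
  have rG : root G x`_i by rewrite Gx root_prod_XsubC mem_nth // sx.
  have Px : P.[x`_i] != 0 by apply/negP => rP; case: (hGP x`_i).
  have Ai := hApos _ (hGab _ rG); have := hid _ (hGab _ rG).
  rewrite (rootP rG) mulr0 add0r => APQ.
  (* After multiplication by A(x_i), the identity turns H(x_i) Q(x_i) into the square of A(x_i)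
     P(x_i), which is nonzero. *)
  rewrite -(pmulr_rgt0 _ Ai) mulrAC -APQ mulrCA -expr2.
  by rewrite lt_neqAle sqr_ge0 eq_sym sqrf_eq0 mulf_neq0 // gt_eqF.
have sQ y : Q = \prod_(z <- y) ('X - z%:P) -> size y = n.+1.
  by move=> Qy; apply/eqP; rewrite -eqSS -hQdeg Qy size_prod_XsubC.
split=> - [u [v [[lu lv] [ou ov] _ h1 h2]]].
  have Qu := lists_zeros_monic hQmonic lu.
  rewrite Gx in lv *; rewrite Pp.
  have vx : v = x.
    by apply: (lists_zeros_sorted_eq lv) => //; exact: (sub_sorted (@ltW _ R)).
  rewrite vx sx (sQ _ Qu) in ov h1 h2.
  by apply: (prec_below sx (sQ _ Qu)) => // i im; apply: sameS.
have Qv := lists_zeros_monic hQmonic lv.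
rewrite Gx in lu *; rewrite Pp.
have ux : u = x.
  by apply: (lists_zeros_sorted_eq lu) => //; exact: (sub_sorted (@ltW _ R)).
rewrite ux sx (sQ _ Qv) in ou h1 h2.
by apply: (prec_above sx (sQ _ Qv)) => // i im; apply: sameS.
Qed.
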